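(* Let $(G,\Omega)$ be a finite (not necessarily primitive) permutation group and let $p$ be a prime. Let $P\in\mathrm{Syl}_p(G)$ and suppose that $P$ is not elementary abelian. Let $z$ be an element of order $p$ in $\Phi(P)\cap Z(P)$. Let $f$ be the number of fixed points of $z$ on $\Omega$, and let $n=|\Omega|$. If $$|G:N_G(P)|<2^{(n-f)(1/p-1/p^2)},$$ then $(G,\Omega)$ is $p$-moderate.
   Context: A permutation group $(G,\Omega)$ is a finite group $G$ acting faithfully on a finite set $\Omega$. $\Phi(P)$ is the Frattini subgroup and $Z(P)$ the center of $P$. The trivial group counts as elementary abelian. For a finite group $X$, $|X|_p$ denotes the largest power of $p$ dividing $|X|$. The permutation group $(G,\Omega)$ is called $p$-moderate if there is a subset $\Delta\subseteq\Omega$ whose setwise stabilizer $\mathrm{Stab}_G(\Delta)$ satisfies $1<|\mathrm{Stab}_G(\Delta)|_p<|G|_p$. *)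

(* Defs.v *)
From HB Require Import structures.
From mathcomp Require Import all_boot all_order all_algebra all_fingroup all_solvable.
From mathcomp Require Import reals exp.

Set Implicit Arguments.
Unset Strict Implicit.
Unset Printing Implicit Defensive.

(* The action is only required to be defined on G itself, and faithfulness is
   a separate hypothesis wherever a permutation group is meant. *)
Definition p_moderate (p : nat) (gT : finGroupType) (G : {group gT})
    (Omega : finType) (to : action G Omega) : Prop :=
  exists Delta : {set Omega}, 1 < #|'N_G(Delta | to)%g|`_p < #|G|`_p.

(* Main.v *)
Require Import Defs.
From HB Require Import structures.
From mathcomp Require Import all_boot all_order all_algebra all_fingroup all_solvable.
From mathcomp Require Import reals exp.
From mathcomp Require lra.

Set Implicit Arguments.
Unset Strict Implicit.
Unset Printing Implicit Defensive.

(** If every subset of Omega whose stabilizer has order divisible by p is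
    stabilized by a full Sylow p-subgroup, then the <[z]>-invariant subsets are
    covered by the Q-invariant ones, Q ranging over the |G : N_G(P)| Sylow
    p-subgroups; counting invariant subsets as 2 ^ (number of orbits) gives
    2 ^ o(z) <= |G : N_G(P)| * 2 ^ o(P).  Here o(z) = f + (n - f) / p, while
    o(P) <= f + (n - f) / p ^ 2: a point stabilizer in P of index at most p is
    P or a maximal subgroup, hence contains Phi(P) and z, so P-orbits of points
    moved by z have length at least p ^ 2.  This contradicts the bound on
    |G : N_G(P)|. *)

Section OrbitCounting.

Import GroupScope.

Variables (aT : finGroupType) (D : {group aT}) (rT : finType).
Variable to : action D rT.
Implicit Types (A : {group aT}) (S X : {set rT}).

Lemma acts_setT A : A \subset D -> [acts A, on [set: rT] | to].
Proof.
move=> sAD; apply/subsetP => a Aa; rewrite !inE (subsetP sAD) //=.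
by apply/subsetP => x _; rewrite !inE.
Qed.

(** An invariant set is a union of orbits, and the set of orbits it contains determines it. *)
Lemma card_acts_set A :
  A \subset D ->
  #|[set X : {set rT} | [acts A, on X | to]]| = (2 ^ #|orbit to A @: setT|)%N.
Proof.
move=> sAD; rewrite -card_powerset.
(* [F O] is the union of the orbits in [O]. It is injective only on families made of genuine orbits,
   hence the restriction to the powerset. *)
pose F (O : {set {set rT}}) := [set x | orbit to A x \in O].
have injF : {in powerset (orbit to A @: setT) &, injective F}.
  move=> U V /[!powersetE] sU sV /setP eqF; apply/setP => O.
  case: (boolP (O \in orbit to A @: setT)) => [/imsetP[x _ ->]|nO].
    by move: (eqF x); rewrite !inE.
  by rewrite (contraNF (subsetP sU O)) ?(contraNF (subsetP sV O)).
rewrite -(card_in_imset injF); congr #|pred_of_set _|.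
apply/setP => X; rewrite inE; apply/idP/imsetP => [actX | [U _ ->]].
  exists (orbit to A @: X); first by rewrite powersetE imsetS ?subsetT.
  apply/setP => x; rewrite inE; apply/idP/imsetP => [Xx | [y Xy /esym xy]].
    by exists x.
  apply: (acts_in_orbit actX _ Xy); rewrite xy; exact: orbit_refl.
apply/subsetP => a Aa; have Da := subsetP sAD a Aa.
rewrite !inE Da /=; apply/subsetP => x; rewrite !inE.
suff -> : orbit to A (to x a) = orbit to A x by [].
by apply/orbit_in_eqP; rewrite ?mem_orbit.
Qed.

Lemma leq_card_orbits A S k :
    [acts A, on S | to] -> (forall x, x \in S -> k <= #|orbit to A x|) ->
  k * #|orbit to A @: S| <= #|S|.
Proof.
move=> /orbit_partition/card_partition -> le_k.
rewrite mulnC -sum_nat_const.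
by apply: leq_sum => _ /imsetP[x Sx ->]; apply: le_k.
Qed.

Lemma geq_card_orbits A S k :
    [acts A, on S | to] -> (forall x, x \in S -> #|orbit to A x| <= k) ->
  #|S| <= k * #|orbit to A @: S|.
Proof.
move=> /orbit_partition/card_partition -> ge_k.
rewrite mulnC -sum_nat_const.
by apply: leq_sum => _ /imsetP[x Sx ->]; apply: ge_k.
Qed.

Lemma astabs_setact_in X a :
  a \in D -> 'N(to^* X a | to) = 'N(X | to) :^ a.
Proof. by move=> Da; rewrite -!astab1_set; apply: (@astab1_act_in _ D). Qed.

(** Translation by [a] carries the [A]-invariant sets onto the [A :^ a]-invariant ones. *)
Lemma card_acts_setJ A a :
  a \in D ->
  #|[set X : {set rT} | [acts A :^ a, on X | to]]| <=
    #|[set X : {set rT} | [acts A, on X | to]]|.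
Proof.
move=> Da; apply: leq_trans (leq_imset_card (to^*^~ a) _).
apply/subset_leq_card/subsetP => X; rewrite inE => actX.
apply/imsetP; exists (to^* X a^-1); last first.
  by rewrite (actKVin to^* Da).
by rewrite inE astabs_setact_in ?groupV // -sub_conjg.
Qed.

Lemma acts_setC A S :
  A \subset D -> [acts A, on S | to] -> [acts A, on ~: S | to].
Proof.
move=> sAD actS; apply/subsetP => a Aa; rewrite !inE (subsetP sAD) //=.
by apply/subsetP => x; rewrite !inE (acts_act actS).
Qed.

(** Each fixed point is an orbit by itself, and every other orbit has at most [#[z]] points.
    Multiplying through by [#[z]] keeps the bound in the natural numbers. *)
Lemma card_orbits_cycle z :
    z \in D ->
  #[z] * #|'Fix_to[z]| + #|~: 'Fix_to[z]|
    <= #[z] * #|orbit to <[z]> @: setT|.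
Proof.
move=> Dz; set F := 'Fix_to[z]; have szD : <[z]> \subset D by rewrite cycle_subG.
have FE : F = 'Fix_to(<[z]>) by rewrite afix_cycle_in.
have actF : [acts <[z]>, on F | to].
  have := acts_subnorm_fix to <[z]>; rewrite (setIidPr szD) -FE.
  by apply: subset_trans; rewrite subsetI szD normG.
have orbF : {in F, forall x, orbit to <[z]> x = [set x]}.
  by move=> x; rewrite FE => /orbit1P.
have orbE : (orbit to <[z]> @: F) :|: (orbit to <[z]> @: ~: F)
              = orbit to <[z]> @: setT.
  by rewrite -imsetU setUCr.
have dis : [disjoint orbit to <[z]> @: F & orbit to <[z]> @: ~: F].
  apply/pred0P => O /=; apply/negP => /andP[/imsetP[x Fx ->] /imsetP[y nFy xy]].
  move: nFy; rewrite inE => /negP[].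
  by apply: (acts_in_orbit actF _ Fx); rewrite xy orbit_refl.
rewrite -orbE cardsU disjoint_setI0 // cards0 subn0 mulnDr leq_add //.
  rewrite card_in_imset // => x y Fx Fy; rewrite !orbF //.
  exact: set1_inj.
apply: geq_card_orbits; first exact: acts_setC.
by move=> x _; rewrite /order leq_imset_card.
Qed.

Lemma card_orbit_moved_Phi (p : nat) (P : {group aT}) z x :
    prime p -> p.-group P -> P \subset D -> z \in 'Phi(P) ->
  x \notin 'Fix_to[z] -> p ^ 2 <= #|orbit to P x|.
Proof.
move=> p_pr pP sPD Phi_z; apply: contraR; rewrite -ltnNge => lt_orb.
suff: z \in 'C_P[x | to] by case/setIP => _ Cz; apply/afix1P/(astab_act Cz)/set11.
rewrite card_orbit_in // in lt_orb.
have pidx : p.-nat #|P : 'C_P[x | to]| by apply: pnat_dvd (dvdn_indexg _ _) pP.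
(* The index of the point stabilizer is a power of [p] below [p ^ 2]: exponent 0 makes it [P],
   exponent 1 makes it maximal, and a larger one is absurd. *)
have [[|[|k]] idxE] := p_natP pidx.
- have /eqP := idxE; rewrite expn0 indexg_eq1 => sPC.
  by apply: (subsetP sPC); apply: (subsetP (Phi_sub P)).
- apply: (subsetP (Phi_sub_max _)) Phi_z.
  by apply: p_index_maximal; rewrite ?subsetIl // idxE expn1.
- by rewrite idxE ltn_exp2l ?prime_gt1 // in lt_orb.
Qed.

Lemma card_orbits_Phi_center (p : nat) (P : {group aT}) z :
    prime p -> p.-group P -> P \subset D -> z \in 'Phi(P) :&: 'Z(P) ->
  p ^ 2 * #|orbit to P @: setT| <= p ^ 2 * #|'Fix_to[z]| + #|~: 'Fix_to[z]|.
Proof.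
move=> p_pr pP sPD /setIP[Phi_z /setIP[Pz cPz]].
have Dz := subsetP sPD z Pz; have szD : <[z]> \subset D by rewrite cycle_subG.
(* Centrality of [z] enters here: [P] normalizes [<[z]>], so it permutes the fixed points of [z]. *)
have actF : [acts P, on 'Fix_to[z] | to].
  have := acts_subnorm_fix to <[z]>.
  rewrite (setIidPr szD) afix_cycle_in //; apply: subset_trans.
  by rewrite subsetI sPD cents_norm // centsC cycle_subG.
rewrite -(setUCr 'Fix_to[z]) imsetU.
apply: (@leq_trans (p ^ 2 * (#|orbit to P @: 'Fix_to[z]| +
                             #|orbit to P @: ~: 'Fix_to[z]|))).
  by rewrite leq_mul2l leq_card_setU orbT.
rewrite mulnDr leq_add ?leq_mul2l ?leq_imset_card ?orbT //.
apply: leq_card_orbits; first exact: acts_setC.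
by move=> x /setCP/negP; apply: card_orbit_moved_Phi.
Qed.

Lemma card_acts_cycle_leq (p : nat) (P : {group aT}) z :
    prime p -> p.-Sylow(D) P -> z \in D -> #[z] = p -> ~ p_moderate p to ->
  #|[set X : {set rT} | [acts <[z]>, on X | to]]| <=
    #|D : 'N_D(P)| * #|[set X : {set rT} | [acts P, on X | to]]|.
Proof.
move=> p_pr sylP Dz oz not_mod.
pose I (Q : {set aT}) : {set {set rT}} := [set X : {set rT} | [acts Q, on X | to]].
apply: (@leq_trans #|\bigcup_(Q in 'Syl_p(D)) I (gval Q)|).
  apply/subset_leq_card/subsetP => X; rewrite inE => actX.
  set N := 'N_D(X | to); have sND : N \subset D by apply: subsetIl.
  have szN : <[z]> \subset N by rewrite subsetI actX cycle_subG Dz.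
  (* Since [z] lies in the stabilizer [N] of [X], the failure of moderateness forces [N] to have the
     full [p]-part of [D]. A Sylow [p]-subgroup of [N] is then one of [D]. *)
  have N_gt1 : 1 < #|N|`_p.
    have: #|<[z]>|`_p <= #|N|`_p.
      by rewrite dvdn_leq ?part_gt0 // partn_dvd // cardSg.
    by rewrite -/(order z) oz part_pnat_id ?pnat_id //; apply/leq_trans/prime_gt1.
  have N_ge : #|D|`_p <= #|N|`_p.
    by rewrite leqNgt; apply/negP => N_lt; apply: not_mod; exists X; rewrite N_gt1.
  have [Q sylQ] := Sylow_exists p N.
  have sQN := pHall_sub sylQ.
  apply/bigcupP; exists Q; last by rewrite inE (subset_trans sQN) ?subsetIr.
  rewrite inE pHallE (subset_trans sQN) //= (card_Hall sylQ) eqn_leq N_ge andbT.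
  by rewrite dvdn_leq ?part_gt0 // partn_dvd // cardSg.
rewrite -(card_Syl sylP) -sum_nat_const.
apply: (@leq_trans (\sum_(Q in 'Syl_p(D)) #|I (gval Q)|)).
  apply: (big_ind2 (fun (U : {set {set rT}}) m => #|U| <= m)) => //.
    by rewrite cards0.
  by move=> U m V k leU leV; apply: leq_trans (leq_card_setU _ _) (leq_add _ _).
(* Each [Q] is conjugate to [P], so it contributes no more invariant sets than [P] does. *)
apply: leq_sum => Q; rewrite inE => sylQ.
have [x Dx ->] := Sylow_trans sylP sylQ.
exact: card_acts_setJ.
Qed.

End OrbitCounting.

Section RealBound.

Import GRing.Theory Num.Theory Order.TTheory.
Import lra.
Local Open Scope ring_scope.

(** Here [m] stands for n - f, [a] and [b] for the numbers of orbits of [<[z]>] and [P], and [i] for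
    the index. Dividing the two orbit bounds by [p] and [p ^ 2] bounds the exponent by [a - b],
    while 2 to the power [a - b] is at most [i]. *)
Lemma powR2_orbit_bound (R : realType) (p a b f m i : nat) :
    (0 < p)%N -> (p * f + m <= p * a)%N -> (p ^ 2 * b <= p ^ 2 * f + m)%N ->
    (2 ^ a <= i * 2 ^ b)%N ->
  ~~ (i%:R < 2 `^ (m%:R * (p%:R^-1 - (p%:R ^+ 2)^-1)) :> R).
Proof.
move=> p_gt0 le_a le_b le_i; rewrite -leNgt.
have le_m : m%:R * (p%:R^-1 - (p%:R ^+ 2)^-1) <= a%:R - b%:R :> R.
  have p0 : 0 < p%:R :> R by rewrite ltr0n.
  have a' : m%:R / p%:R <= a%:R - f%:R :> R.
    rewrite ler_pdivrMr //.
    by move: le_a; rewrite -(ler_nat R) natrD !natrM => ?; lra.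
  have b' : b%:R - f%:R <= m%:R / p%:R ^+ 2 :> R.
    rewrite ler_pdivlMr ?exprn_gt0 //.
    by move: le_b; rewrite -(ler_nat R) natrD !natrM => ?; lra.
  by rewrite mulrBr; lra.
apply: le_trans (ler_powR _ le_m) _; first by rewrite ler1n.
rewrite powRB; last by rewrite pnatr_eq0 implybT.
rewrite !powR_mulrn ?ler0n //.
by rewrite ler_pdivrMr ?exprn_gt0 ?ltr0n // -!natrX -natrM ler_nat.
Qed.

End RealBound.

Theorem proposition3p1 (R : realType) (gT : finGroupType) (G : {group gT})
    (Omega : finType) (to : action G Omega)
    (faithfulG : [faithful G, on [set: Omega] | to])
    (p : nat) (p_prime : prime p)
    (P : {group gT}) (sylP : (p.-Sylow(G) P)%g) (not_abelemP : ~~ (p.-abelem P)%g)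
    (z : gT) (z_in : z \in ('Phi(P) :&: 'Z(P))%g) (order_z : #[z]%g = p)
    (f : nat) (f_def : f = #|'Fix_to[z]%g|) (n : nat) (n_def : n = #|Omega|)
    (index_lt : (#|G : 'N_G(P)|%g%:R <
       2 `^ ((n%:R - f%:R) * (p%:R^-1 - (p%:R ^+ 2)^-1)) :> R)%R) :
  p_moderate p to.
Proof.
apply: boolp.contrapT => not_mod.
have sPG := pHall_sub sylP.
have Gz : z \in G by case/setIP: z_in => /(subsetP (Phi_sub P))/(subsetP sPG).
have := card_acts_cycle_leq p_prime sylP Gz order_z not_mod.
rewrite !card_acts_set ?cycle_subG // => le_i.
have := card_orbits_cycle to Gz; rewrite order_z => le_a.
have le_b := card_orbits_Phi_center to p_prime (pHall_pgroup sylP) sPG z_in.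
have := powR2_orbit_bound R (prime_gt0 p_prime) le_a le_b le_i.
(* The moved points number [n - f]; the cast to [R] respects this truncated subtraction because
   [f <= n]. *)
rewrite cardsCs setCK -f_def -n_def GRing.natrB ?index_lt //.
by rewrite f_def n_def max_card.
Qed.
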